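(* The sporadic simple Mathieu group $M_{23}$ (of order $10200960$) has an Ordered Generating System.
   Context: Definition. A sequence of elements $a_1,\ldots,a_n$ of a group $G$ is an Ordered Generating System of $G$ if there exist non-negative integers $m_1,\ldots,m_n$ such that every element $g\in G$ has a unique representation of the form $g=a_1^{i_1}a_2^{i_2}\cdots a_n^{i_n}$ with integers $0\le i_k\le m_k$ for every $1\le k\le n$ (i.e. the exponent tuple $(i_1,\ldots,i_n)$ in this range exists and is unique). A group is said to have an Ordered Generating System if such a finite sequence exists. *)

(* Defs.v *)
From HB Require Import structures.
From mathcomp Require Import all_boot all_order all_algebra all_fingroup.

Set Implicit Arguments.
Unset Strict Implicit.
Unset Printing Implicit Defensive.

Import GRing.Theory.

(* The bounds [m] are natural numbers, so a group with an ordered generating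
   system is finite and there is no loss in working inside a finGroupType.
   The product is the ordered (noncommutative) group product. *)
Definition is_OGS (gT : finGroupType) (G : {group gT}) (n : nat)
    (a : n.-tuple gT) : Prop :=
  (forall k : 'I_n, tnth a k \in G) /\
  exists m : n.-tuple nat,
    forall g : gT, g \in G ->
      exists! i : n.-tuple nat,
        (forall k : 'I_n, tnth i k <= tnth m k) /\
        g = (\prod_(k < n) tnth a k ^+ tnth i k)%g.

Definition has_OGS (gT : finGroupType) (G : {group gT}) : Prop :=
  exists (n : nat) (a : n.-tuple gT), is_OGS G a.

(* The row space is the perfect binary Golay code [23, 12, 7], realised as the
   binary quadratic residue code of length 23: row i is the indicator vector of
   i + Q, where Q is the set of the 11 nonzero squares modulo 23.  Arithmetic
   on 'I_23 is arithmetic modulo 23. *)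
Definition golay23 : 'M['F_2]_23 :=
  (\matrix_(i < 23, j < 23)
     ([exists x : 'I_23, (x != 0) && (j - i == x ^+ 2)] : nat)%:R)%R.

(* The Mathieu group M_23, as the group of all coordinate permutations that
   preserve the binary Golay code of length 23. *)
Definition M23_set : {set 'S_23} := [set s | stablemx golay23 (perm_mx s)].

Lemma M23_group_set : group_set M23_set.
Proof.
apply/group_setP; split=> [|s t]; rewrite !inE.
  by rewrite perm_mx1 stablemxC.
by move=> Ns Nt; rewrite perm_mxM stablemxM.
Qed.

Definition M23 : {group 'S_23} := Group M23_group_set.

(* Main.v *)
(* Take a base 0, 1, 2, 3, 4, 9, ... of M_23 and its chain of pointwise
   stabilizers.  If elements of G, ordered and with bounded exponents, move a
   point x exactly once to each point of its G-orbit, then appending them to an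
   ordered generating system of the stabilizer of x gives one for G.  Here the
   orbits have lengths 23, 22, 21, 20, 16, 3 and then 1.  The listed elements
   bound them from below.  For the upper bound, the Golay code has minimum
   weight 7, so two codewords of weight 7 (heptads) sharing four points are
   equal; hence a permutation fixing four points of a heptad preserves it, and
   this confines the image of each base point. *)
Require Import Defs.
From mathcomp Require Import all_boot all_order all_algebra all_fingroup.

Set Implicit Arguments.
Unset Strict Implicit.
Unset Printing Implicit Defensive.

Import GRing.Theory.

(** * Factorizations with bounded exponents, on sequences *)

Definition admissible T (s : seq (T * nat)) (e : seq nat) :=
  all2 (fun p k => k <= p.2) s e.

Definition exponents T : seq (T * nat) -> seq (seq nat) :=
  foldr (fun p es => [seq k :: e | k <- iota 0 p.2.+1, e <- es]) [:: [::]].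

Lemma mem_exponents T (s : seq (T * nat)) e :
  (e \in exponents s) = admissible s e.
Proof.
elim: s e => [[]|p s IH e] //.
have -> : exponents (p :: s) =
  [seq k :: f | k <- iota 0 p.2.+1, f <- exponents s] by [].
apply/allpairsP/idP => [[[k f] [+ + ->]]|].
  by rewrite mem_iota IH => /= k_le ->; rewrite andbT.
case: e => // k e /andP[k_le adm_e].
by exists (k, e); split; rewrite ?mem_iota ?IH.
Qed.

Section OrderedFactorization.

Local Open Scope group_scope.

Variable gT : finGroupType.
Implicit Types (G H : {set gT}) (s t : seq (gT * nat)) (e f : seq nat).

Definition ordered_prod s e : gT := \prod_(p <- zip s e) p.1.1 ^+ p.2.

(** The counterpart of [is_OGS] on sequences, which concatenate without a length index. *)
Definition factorizes G s : Prop :=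
  (forall p, p \in s -> p.1 \in G) /\
  forall g, g \in G -> exists! e, admissible s e /\ g = ordered_prod s e.

Lemma admissible_size s e : admissible s e -> size s = size e.
Proof. by rewrite /admissible all2E => /andP[/eqP]. Qed.

Lemma ordered_prod_cat s t e f : size s = size e ->
  ordered_prod (s ++ t) (e ++ f) = ordered_prod s e * ordered_prod t f.
Proof. by move=> se; rewrite /ordered_prod zip_cat // big_cat. Qed.

Lemma admissible_cat s t e f : size s = size e ->
  admissible (s ++ t) (e ++ f) = admissible s e && admissible t f.
Proof.
by move=> se; rewrite /admissible !all2E zip_cat // all_cat !size_cat se
  eqn_add2l eqxx /= andbCA.
Qed.

Lemma ordered_prod_in (G : {group gT}) t f :
  (forall p, p \in t -> p.1 \in G) -> ordered_prod t f \in G.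
Proof.
elim: t f => [|p t IH] [|k f] Gt; rewrite /ordered_prod ?big_nil ?group1 //=.
rewrite big_cons groupM ?groupX ?Gt ?mem_head //=.
by apply: IH => q tq; rewrite Gt // inE tq orbT.
Qed.

Lemma has_OGS_factorizes (G : {group gT}) s : factorizes G s -> has_OGS G.
Proof.
case=> Gs facG; pose n := size s; pose p0 : gT * nat := (1, 0).
have nth_a k : nth 1 (unzip1 s) k = (nth p0 s k).1.
  by rewrite -[1]/(p0.1); case: (ltnP k n) => kn;
    [rewrite (nth_map p0) | rewrite !nth_default ?size_map].
have nth_m k : nth 0 (unzip2 s) k = (nth p0 s k).2.
  by rewrite -[0]/(p0.2); case: (ltnP k n) => kn;
    [rewrite (nth_map p0) | rewrite !nth_default ?size_map].
pose a := map_tuple fst (in_tuple s); pose m := map_tuple snd (in_tuple s).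
have admE (i : n.-tuple nat) :
    (forall k : 'I_n, tnth i k <= tnth m k) <-> admissible s i.
  rewrite /admissible all2E size_tuple eqxx /=; split.
    move=> le_im; apply/(all_nthP (p0, 0)); rewrite size_zip size_tuple minnn.
    move=> k kn; have := le_im (Ordinal kn).
    by rewrite nth_zip ?size_tuple //= !(tnth_nth 0) /= nth_m.
  move/(all_nthP (p0, 0)); rewrite size_zip size_tuple minnn => le_im k.
  have:= le_im k (ltn_ord k).
  by rewrite nth_zip ?size_tuple //= !(tnth_nth 0) /= nth_m.
have prodE (i : n.-tuple nat) :
    (\prod_(k < n) tnth a k ^+ tnth i k)%g = ordered_prod s i.
  rewrite /ordered_prod (big_nth (p0, 0)) size_zip size_tuple minnn big_mkord.
  apply: eq_bigr => k _; rewrite nth_zip ?size_tuple //=.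
  by rewrite (tnth_nth 1) (tnth_nth 0) /= nth_a.
exists n, a; split=> [k|]; first by rewrite tnth_map Gs // mem_tnth.
exists m => g /facG[e [[adm_e ->] uniq_e]].
have se : size e == n by rewrite -(admissible_size adm_e).
exists (Tuple se); split=> [|f [/admE adm_f prod_f]].
  by split; [apply/admE | rewrite prodE].
by apply/val_inj/uniq_e; split; rewrite // prod_f prodE.
Qed.

End OrderedFactorization.

(** * Lifting a factorization from a point stabilizer *)

Section PermStep.

Local Open Scope group_scope.

Variable T : finType.

(** Elements of [H] fix [x] and the left factor acts first, so the image of [x] depends on the [t]
    factor alone. It determines the exponents of that factor, and cancelling the factor leaves an
    element of [H]. *)
Lemma factorizes_stab_step (G : {group {perm T}}) (H : {set {perm T}}) x
    (s t : seq ({perm T} * nat)) :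
    (forall g, (g \in H) = (g \in G) && (g x == x)) ->
    (forall p, p \in t -> p.1 \in G) ->
    (forall e f, admissible t e -> admissible t f ->
      ordered_prod t e x = ordered_prod t f x -> e = f) ->
    (forall g, g \in G -> exists2 f, admissible t f & g x = ordered_prod t f x) ->
  factorizes H s -> factorizes G (s ++ t).
Proof.
move=> HE Gt injt ontot [Hs facH]; split=> [p|g Gg].
  by rewrite mem_cat => /orP[/Hs|/Gt //]; rewrite HE => /andP[].
have [f adm_f gx] := ontot g Gg; pose h := g * (ordered_prod t f)^-1.
have Hh : h \in H.
  rewrite HE /h groupM ?groupV ?ordered_prod_in //=.
  by rewrite permM gx permK.
have [e [[adm_e he] uniq_e]] := facH h Hh.
have se := admissible_size adm_e.
exists (e ++ f); split.
  rewrite admissible_cat // adm_e adm_f ordered_prod_cat // -he.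
  by rewrite /h mulgKV.
move=> ef [adm_ef g_ef].
pose e' := take (size s) ef; pose f' := drop (size s) ef.
have se' : size s = size e'.
  rewrite size_takel // -(admissible_size adm_ef) size_cat; exact: leq_addr.
rewrite -(cat_take_drop (size s) ef) -/e' -/f' in adm_ef g_ef *.
move: adm_ef g_ef; rewrite admissible_cat // ordered_prod_cat //.
case/andP=> adm_e' adm_f' g_ef.
have He' : ordered_prod s e' \in H.
  (* [H] is only a set; as a stabilizer it is a group, which [ordered_prod_in] requires. *)
  have -> : H = [group of 'C_G[x | 'P]].
    by apply/setP=> k; rewrite HE !inE /= sub1set inE /= apermE.
  apply: ordered_prod_in => p /Hs.
  by rewrite HE !inE /= sub1set inE /= apermE.
have ff' : f = f'.
  apply: injt => //; rewrite -gx g_ef permM.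
  by move: He'; rewrite HE => /andP[_ /eqP->].
congr (_ ++ _) => //; apply: uniq_e; split=> //.
by rewrite /h g_ef ff' mulgK.
Qed.

End PermStep.

(** * Permutations of 23 points given by tables *)

Definition perm_table (l : seq nat) : 'S_23 :=
  if injectiveP (fun i : 'I_23 => inord (nth 0 l i) : 'I_23) is ReflectT inj
  then perm inj else 1%g.

Lemma perm_tableE l (i : 'I_23) : perm_eq l (iota 0 23) ->
  perm_table l i = nth 0 l i :> nat.
Proof.
move=> l_perm; have sl : size l = 23 by rewrite (perm_size l_perm) size_iota.
have ltl k : k < 23 -> nth 0 l k < 23.
  move=> k23; have: nth 0 l k \in l by rewrite mem_nth // sl.
  by rewrite (perm_mem l_perm) mem_iota.
rewrite /perm_table; case: injectiveP => [inj|[]].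
  by rewrite permE inordK ?ltl.
move=> j k /(congr1 val); rewrite /= !inordK ?ltl // => /eqP.
rewrite nth_uniq ?sl // ?(perm_uniq l_perm) ?iota_uniq //.
by move/eqP/val_inj.
Qed.

(** Staying in [nat] lets [vm_compute] find the orbits; [foldl] agrees with the left factor acting
    first. *)
Definition table_image (t : seq (seq nat * nat)) (x : nat) (e : seq nat) : nat :=
  foldl (fun y p => iter p.2 (nth 0 p.1.1) y) x (zip t e).

Lemma ordered_prod_tables t e (x : 'I_23) :
    all (fun p => perm_eq p.1 (iota 0 23)) t ->
  ordered_prod [seq (perm_table p.1, p.2) | p <- t] e x = table_image t x e :> nat.
Proof.
elim: t e x => [|[l m] t IH] [|k e] x; rewrite /ordered_prod /table_image.
- by rewrite /= big_nil perm1.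
- by rewrite /= big_nil perm1.
- by rewrite /= big_nil perm1.
case/andP=> l_perm /IH tE; rewrite /= big_cons permM /= tE /table_image; congr foldl.
rewrite permX; elim: k => //= k <-.
by rewrite perm_tableE.
Qed.

Lemma map_uniq_inj (S T : eqType) (f : S -> T) s :
  uniq (map f s) -> {in s &, injective f}.
Proof.
elim: s => //= x s IH /andP[fx_s /IH inj] y z.
rewrite !inE => /predU1P[->|ys] /predU1P[->|zs] //; last exact: inj.
- by move=> fxz; rewrite fxz map_f in fx_s.
- by move=> fyx; rewrite -fyx map_f in fx_s.
Qed.

(** * The Golay code in boolean form and its minimum weight *)

Definition parity : seq bool -> bool := foldr addb false.

Lemma F2_natr_inj : injective (fun b : bool => (b%:R : 'F_2)%R).
Proof. by move=> [] [] // /eqP. Qed.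

Lemma F2_parity (I : Type) (s : seq I) (F : I -> bool) :
  (\sum_(i <- s) (F i)%:R = (parity [seq F i | i <- s])%:R :> 'F_2)%R.
Proof.
elim: s => [|i s IH]; first by rewrite big_nil.
by rewrite big_cons IH /=; case: (F i); case: parity; apply/eqP.
Qed.

Definition squares23 : seq nat := [:: 1; 2; 3; 4; 6; 8; 9; 12; 13; 16; 18].

Definition golay_entry (i j : nat) : bool :=
  (j + (23 - i)) %% 23 \in squares23.

Lemma golay23E (i j : 'I_23) : (golay23 i j = (golay_entry i j)%:R)%R.
Proof.
rewrite mxE /golay_entry; congr ((nat_of_bool _)%:R)%R.
set d := (j - i)%R; have <- : nat_of_ord d = (j + (23 - i)) %% 23.
  by rewrite /= modnDmr.
apply/existsP/idP => [[x /andP[x_neq0 /eqP->]]|d_sq].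
  have /allP/(_ (val x)) : all (fun x => (x == 0) ||
      (x * x %% 23 \in squares23)) (iota 0 23).
    by [].
  rewrite mem_iota ltn_ord => /(_ isT).
  by rewrite -[x == 0%R :> nat]/(x == 0%R) (negPf x_neq0).
have /allP/(_ _ d_sq)/hasP[x x_lt /andP[x_neq0 /eqP xx]] :
    all (fun d => has (fun x => (x != 0) && (x * x %% 23 == d)) (iota 0 23))
      squares23 by [].
rewrite mem_iota in x_lt.
by exists (Ordinal x_lt); rewrite -val_eqE /= x_neq0 -val_eqE /= xx.
Qed.

Definition indic (A : {set 'I_23}) : 'rV['F_2]_23 := (\row_j (j \in A)%:R)%R.

(* The taps are the coefficients of the check polynomial of the cyclic code,
   which has degree 12. *)
Definition taps : seq nat := [:: 0; 1; 2; 3; 6; 9; 11].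

Lemma golay_entry_recurrence i n : i < 23 -> 12 <= n < 23 ->
  golay_entry i n = parity [seq golay_entry i (n - d.+1) | d <- taps].
Proof.
have /allP rec : all (fun i => all (fun n => golay_entry i n ==
    parity [seq golay_entry i (n - d.+1) | d <- taps]) (iota 12 11)) (iota 0 23).
  by vm_compute.
move=> i_lt n_lt; have:= rec i; rewrite mem_iota => /(_ i_lt)/allP/(_ n).
by rewrite mem_iota => /(_ n_lt)/eqP.
Qed.

(** The recurrence is linear, so it passes from the rows, where it is computed, to their
    combinations. *)
Lemma golay_recurrence A n : (indic A <= golay23)%MS -> 12 <= n < 23 ->
  (inord n \in A) = parity [seq inord (n - d.+1) \in A | d <- taps].
Proof.
case/submxP=> u uG /andP[n_ge n_lt].
have AE k : k < 23 ->
    ((inord k \in A)%:R = \sum_i u 0 i * (golay_entry i k)%:R :> 'F_2)%R.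
  move=> k_lt; have:= congr1 (fun v : 'rV_23 => v 0%R (inord k)) uG.
  rewrite !mxE => ->; apply: eq_bigr => i _.
  by rewrite golay23E inordK.
apply: F2_natr_inj; rewrite -F2_parity AE //.
under [RHS]eq_bigr => d _ do
  rewrite AE ?(leq_ltn_trans (leq_subr _ _) n_lt) //.
rewrite exchange_big; apply: eq_bigr => i _ /=.
rewrite -big_distrr F2_parity; congr (_ * (nat_of_bool _)%:R)%R.
by apply: golay_entry_recurrence; rewrite ?ltn_ord ?n_ge.
Qed.

(** Recursion on the predicate visits all words of length [n] without building their list. *)
Fixpoint forall_bits (n : nat) (P : pred (seq bool)) : bool :=
  if n is n'.+1
  then forall_bits n' (fun w => P (true :: w)) &&
       forall_bits n' (fun w => P (false :: w))
  else P [::].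

Lemma forall_bitsP n P w : forall_bits n P -> size w = n -> P w.
Proof.
by elim: n P w => [|n IH] P [|[] w] //= /andP[Pt Pf] [sw];
  [apply: IH Pt sw | apply: IH Pf sw].
Qed.

(** The newest bit comes first, so tap [d] reads the bit [d + 1] places before the new one. *)
Definition shift_register (w : seq bool) : seq bool :=
  parity [seq nth false w d | d <- taps] :: w.

(** By the recurrence the first 12 coordinates determine a codeword, so running the register on all
    2^12 seeds meets every codeword. *)
Lemma golay_min_weight A : (indic A <= golay23)%MS -> #|A| <= 6 -> A = set0.
Proof.
move=> AG A_le6; pose f k := inord k \in A.
have wordE n : n <= 11 ->
    rev (mkseq f (n + 12)) = iter n shift_register (rev (mkseq f 12)).
  elim: n => // n IH n_lt; rewrite iterS -(IH (ltnW n_lt)).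
  rewrite addSn mkseqS rev_rcons /shift_register; congr (_ :: _).
  rewrite /f golay_recurrence //; last first.
    by rewrite leq_addl -[23]/(11 + 12) ltn_add2r.
  congr parity; apply/eq_in_map => d d_tap.
  have d_lt : d < n + 12.
    by apply: leq_trans (leq_addl n 12); move: d d_tap; apply/allP.
  rewrite nth_rev size_mkseq // nth_mkseq //.
  by rewrite subnSK // leq_subr.
have cardA : #|A| = count id (rev (mkseq f 23)).
  rewrite count_rev /mkseq -val_enum_ord -map_comp count_map cardE size_filter.
  by rewrite [in RHS]enumT; apply: eq_count => i /=; rewrite /f inord_val.
(* [iota 1 6] lists the weights 1 to 6; weight 0 stays allowed for the zero word. *)
have /forall_bitsP/(_ (size_mkseq f 12)) : forall_bits 12 (fun w =>
    count id (iter 11 shift_register (rev w)) \notin iota 1 6) by vm_compute.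
rewrite -wordE // -cardA mem_iota ltnS A_le6 andbT lt0n negbK.
by rewrite cards_eq0 => /eqP.
Qed.

(** * Permuted codewords and heptads *)

Lemma indic_perm A (s : 'S_23) :
  (indic A *m perm_mx s)%R = indic (s @: A).
Proof.
rewrite -[s in LHS]invgK -col_permE; apply/rowP => j; rewrite !mxE.
by rewrite -[j in RHS](permKV s) mem_imset //; apply: perm_inj.
Qed.

Lemma indic_symdiff A B :
  (indic A + indic B)%R = indic ((A :\: B) :|: (B :\: A)).
Proof.
apply/rowP => j; rewrite !mxE !inE.
by do 2!case: (_ \in _); apply/eqP.
Qed.

Definition points (h : seq nat) : {set 'I_23} := [set i | val i \in h].

Definition valid_points (h : seq nat) : bool := uniq h && all (gtn 23) h.

Lemma filter_valid_points h : valid_points h ->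
  perm_eq [seq i <- iota 0 23 | i \in h] h.
Proof.
case/andP=> uh /allP h_lt; apply: uniq_perm => //.
  exact/filter_uniq/iota_uniq.
move=> i; rewrite mem_filter mem_iota andb_idr //; exact: h_lt.
Qed.

Lemma card_points h : valid_points h -> #|points h| = size h.
Proof.
move/filter_valid_points/perm_size <-.
rewrite size_filter -val_enum_ord count_map cardE size_filter enumT.
by apply: eq_count => i; rewrite /= inE.
Qed.

Definition codeword (h : seq nat) : bool :=
  valid_points h &&
  all (fun j => (j \in h) == parity [seq golay_entry i j | i <- h]) (iota 0 23).

(* [golay23] is idempotent, so a vector lies in its row space when it is fixed
   by multiplication by [golay23]. *)
Lemma codeword_indic h : codeword h -> (indic (points h) <= golay23)%MS.
Proof.
case/andP=> vh /allP hG.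
suff -> : indic (points h) = (indic (points h) *m golay23)%R.
  exact: submxMl.
apply/rowP => j; rewrite !mxE inE (eqP (hG (val j) _)) ?mem_iota ?ltn_ord //.
rewrite -F2_parity -(perm_big _ (filter_valid_points vh)) big_filter.
rewrite -[iota 0 23]/(index_iota 0 23) big_mkord big_mkcond.
apply: eq_bigr => i _; rewrite golay23E mxE inE.
by case: (_ \in _); rewrite ?mul1r ?mul0r.
Qed.

(* The heptads form a single orbit of length 23 * 11 under the maps
   [p |-> a * p + b] with [a] a square. *)
Definition heptads : seq (seq nat) :=
  [seq [seq (a * p + b) %% 23 | p <- [:: 0; 1; 2; 3; 9; 12; 21]]
     | a <- squares23, b <- iota 0 23].

Lemma heptadP h : h \in heptads -> codeword h /\ size h = 7.
Proof.
have /allP H : all (fun h => codeword h && (size h == 7)) heptads by vm_compute.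
by move/H=> /andP[-> /eqP].
Qed.

Definition fixes (s : 'S_23) (X : seq nat) : Prop :=
  forall i : 'I_23, val i \in X -> s i = i.

Lemma heptad_invariant X h s (i : 'I_23) : h \in heptads ->
    4 <= count (mem X) h -> s \in M23 -> fixes s X ->
  (val (s i) \in h) = (val i \in h).
Proof.
case/heptadP => hc h7 hX sM sX; have /andP[vh _] := hc.
pose A := points h; pose B := s @: A.
have AG : (indic A <= golay23)%MS by apply: codeword_indic.
have BG : (indic B <= golay23)%MS.
  rewrite -indic_perm; move: sM; rewrite inE => sM.
  exact: submx_trans (submxMr _ AG) sM.
have cA : #|A| = 7 by rewrite card_points.
have cB : #|B| = 7 by rewrite card_imset //; apply: perm_inj.
have cAB : 4 <= #|A :&: B|.
  rewrite (leq_trans hX) // -size_filter -card_points; last first.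
    case/andP: vh => uh /allP h_lt; rewrite /valid_points filter_uniq //=.
    by apply/allP=> j; rewrite mem_filter => /andP[_ /h_lt].
  apply/subset_leq_card/subsetP => j; rewrite !inE mem_filter /=.
  move=> /andP[jX jh]; rewrite jh /=.
  by apply/imsetP; exists j; rewrite ?inE ?sX.
have AB : A = B.
  (* Over ['F_2] the symmetric difference is the sum of two codewords; its weight is at most (7 - 4)
     + (7 - 4) = 6. *)
  have D0 : (A :\: B) :|: (B :\: A) = set0.
    apply: golay_min_weight; first by rewrite -indic_symdiff addmx_sub.
    apply: leq_trans (leq_card_setU _ _) _.
    rewrite !cardsD cA cB [B :&: A]setIC.
    by rewrite -[6]/(3 + 3) leq_add // leq_subLR -[7]/(4 + 3) leq_add2r.
  apply/setP => j; move/setP/(_ j): D0; rewrite !inE.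
  by case: (_ \in h); case: (_ \in B).
have : (s i \in B) = (i \in A) by rewrite mem_imset //; apply: perm_inj.
by rewrite -AB !inE.
Qed.

(** * Pointwise stabilizers and upper bounds on their orbits *)

Definition stab (X : seq nat) : {group 'S_23} := 'C_M23(points X | 'P)%G.

Lemma stabP s X : reflect (s \in M23 /\ fixes s X) (s \in stab X).
Proof.
apply: (iffP setIP) => -[sM sX]; split=> //.
  by move=> i iX; rewrite -[s i]/('P%act i s) (astab_act sX) ?inE.
by apply/astabP => i; rewrite inE => /sX.
Qed.

Lemma stab_cons s (x : 'I_23) X :
  (s \in stab (val x :: X)) = (s \in stab X) && (s x == x).
Proof.
apply/stabP/andP => [[sM sX]|[/stabP[sM sX] /eqP sx]].
  split; last by rewrite sX ?mem_head.
  by apply/stabP; split=> // i iX; apply: sX; rewrite inE iX orbT.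
by split=> // i; rewrite inE => /predU1P[/val_inj->|/sX].
Qed.

(* A permutation in [stab X] preserves every heptad with at least four points
   in [X]. *)
Definition candidates (X : seq nat) (x : nat) : seq nat :=
  let hs := [seq h <- heptads | 4 <= count (mem X) h] in
  [seq y <- iota 0 23 | all (fun z => (y == z) == (x == z)) X &&
                        all (fun h => (y \in h) == (x \in h)) hs].

Lemma stab_candidates s X (x : 'I_23) :
  s \in stab X -> val (s x) \in candidates X (val x).
Proof.
case/stabP=> sM sX; rewrite mem_filter mem_iota ltn_ord !andbT.
apply/andP; split; apply/allP.
  move=> z zX; case: (ltnP z 23) => [z_lt|z_ge].
    have sz : s (Ordinal z_lt) = Ordinal z_lt by apply: sX.
    by rewrite -[z]/(val (Ordinal z_lt)) -{1}sz !val_eqE (inj_eq perm_inj).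
  (* An entry [z] of [X] above 22 names no point, so both comparisons are false. *)
  by rewrite !ltn_eqF ?(leq_trans (ltn_ord _) z_ge).
move=> h; rewrite mem_filter => /andP[hX hh]; apply/eqP.
exact: heptad_invariant hX sM sX.
Qed.

(** * Checking the generators and the stabilizer chain *)

Definition automorphism_table (l : seq nat) : bool :=
  perm_eq l (iota 0 23) &&
  all (fun i => codeword [seq nth 0 l j | j <- iota 0 23 & golay_entry i j])
      (iota 0 23).

(** The rows span the code, so it is enough that each row is sent to a codeword. *)
Lemma perm_table_M23 l : automorphism_table l -> perm_table l \in M23.
Proof.
case/andP=> l_perm /allP lG; rewrite inE; apply/row_subP => i.
have rowE : row i golay23 = indic [set j : 'I_23 | golay_entry i j].
  by apply/rowP => j; rewrite !mxE inE -golay23E mxE.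
rewrite row_mul rowE indic_perm.
have := codeword_indic (lG i _); rewrite mem_iota ltn_ord => /(_ isT).
congr (indic _ <= _)%MS; apply/setP => j; rewrite inE.
apply/mapP/imsetP => [[k]|[k]].
  rewrite mem_filter mem_iota => /andP[ik k_lt] jE.
  by exists (Ordinal k_lt); rewrite ?inE //; apply/val_inj; rewrite /= perm_tableE.
rewrite inE => ik ->; exists (val k); last by rewrite /= perm_tableE.
by rewrite mem_filter ik mem_iota ltn_ord.
Qed.

(** Distinct images make the exponents unique; images covering the candidates make them exist. The
    orbit is then squeezed between images and candidates, so all three coincide. *)
Definition level_ok (X : seq nat) (x : nat) (t : seq (seq nat * nat)) : bool :=
  let images := [seq table_image t x e | e <- exponents t] in
  [&& x < 23,
      all (fun p => automorphism_table p.1 &&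
                    all (fun z => nth 0 p.1 z == z) X) t,
      uniq images & all (mem images) (candidates X x)].

(** The chain may end only once every point is fixed, where the stabilizer is visibly trivial. *)
Fixpoint chain_ok (X : seq nat) c : bool :=
  if c is (x, t) :: c'
  then level_ok X x t && chain_ok (x :: X) c' else all (mem X) (iota 0 23).

Definition perms_of (t : seq (seq nat * nat)) :=
  [seq (perm_table p.1, p.2) | p <- t].

(** Each level is appended to the right of its stabilizer, so the deepest level comes first. *)
Definition chain_perms (c : seq (nat * seq (seq nat * nat))) :=
  flatten (rev [seq perms_of l.2 | l <- c]).

Lemma chain_perms_cons x t c :
  chain_perms ((x, t) :: c) = chain_perms c ++ perms_of t.
Proof. by rewrite /chain_perms /= rev_cons flatten_rcons. Qed.

Lemma factorizes_chain X c : chain_ok X c -> factorizes (stab X) (chain_perms c).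
Proof.
elim: c X => [|[x t] c IH] X.
  move=> /allP Xfull; split=> // s /stabP[_ sX].
  have -> : s = 1%g.
    by apply/permP => i; rewrite perm1 sX //; apply: Xfull; rewrite mem_iota ltn_ord.
  exists [::]; split=> [|e [adm_e _]]; first by rewrite /ordered_prod big_nil.
  by apply/esym/size0nil; rewrite -(admissible_size adm_e).
rewrite chain_perms_cons => /andP[/and4P[x_lt /allP tX im_uniq /allP im_all] /IH].
have admE e : admissible (perms_of t) e = admissible t e.
  rewrite /admissible; elim: (t) e => [|p t' IHt] [|k e] //=.
  by rewrite -IHt.
have t_perm : all (fun p => perm_eq p.1 (iota 0 23)) t.
  by apply/allP => p /tX /andP[/andP[]].
have imageE e : ordered_prod (perms_of t) e (Ordinal x_lt) = table_image t x e :> nat.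
  exact: ordered_prod_tables.
apply: (factorizes_stab_step (x := Ordinal x_lt)).
- by move=> s; rewrite -stab_cons.
- move=> _ /mapP[p /tX /andP[aut_p /allP pX] ->] /=.
  apply/stabP; split=> [|i iX]; first exact: perm_table_M23.
  apply/val_inj; rewrite /= perm_tableE; first exact/eqP/pX.
  by case/andP: aut_p.
- move=> e f; rewrite !admE -!mem_exponents => te tf.
  by move/(congr1 val); rewrite /= !imageE; apply: map_uniq_inj te tf.
move=> s /(stab_candidates (Ordinal x_lt))/im_all/mapP[e te sx].
exists e; first by rewrite admE -mem_exponents.
by apply/val_inj; rewrite /= imageE.
Qed.

(** The orbit lengths factor as 23, 2 * 11, 3 * 7, 4 * 5, 2^4 and 3, each factor being a bound plus
    one. The first table is translation by 1. At 1, an involution swaps the square 1 with the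
    nonsquare 5, and doubling, of order 11, runs through each class. At 4, four involutions fix the
    heptad {0, 1, 2, 3, 9, 12, 21} pointwise and reach the 16 points off it; at 9, the last table
    cycles 9, 21, 12. The remaining points are already fixed and need no generator. *)
Definition M23_chain : seq (nat * seq (seq nat * nat)) :=
  [:: (0, [:: ([:: 1; 2; 3; 4; 5; 6; 7; 8; 9; 10; 11; 12; 13; 14; 15; 16; 17;
                   18; 19; 20; 21; 22; 0], 22)]);
      (1, [:: ([:: 0; 5; 9; 22; 4; 1; 16; 10; 8; 2; 7; 15; 19; 21; 14; 11; 6;
                   17; 18; 12; 20; 13; 3], 1);
              ([:: 0; 2; 4; 6; 8; 10; 12; 14; 16; 18; 20; 22; 1; 3; 5; 7; 9; 11;
                   13; 15; 17; 19; 21], 10)]);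
      (2, [:: ([:: 0; 1; 5; 13; 8; 17; 12; 10; 9; 4; 22; 11; 20; 15; 16; 3; 18;
                   2; 14; 19; 6; 21; 7], 2);
              ([:: 0; 1; 3; 4; 6; 9; 10; 18; 19; 8; 12; 13; 16; 5; 17; 21; 2;
                   22; 14; 20; 11; 7; 15], 6)]);
      (3, [:: ([:: 0; 1; 2; 6; 9; 14; 12; 5; 11; 19; 13; 8; 18; 15; 16; 17; 7;
                   10; 3; 21; 22; 4; 20], 3);
              ([:: 0; 1; 2; 4; 5; 11; 16; 21; 13; 18; 8; 14; 19; 9; 3; 22; 20;
                   12; 10; 15; 7; 6; 17], 4)]);
      (4, [:: ([:: 0; 1; 2; 3; 5; 4; 15; 22; 17; 9; 19; 14; 12; 20; 11; 6; 18;
                   8; 16; 10; 13; 21; 7], 1);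
              ([:: 0; 1; 2; 3; 6; 15; 4; 14; 20; 9; 16; 22; 12; 17; 7; 5; 10;
                   13; 19; 18; 8; 21; 11], 1);
              ([:: 0; 1; 2; 3; 7; 22; 14; 4; 16; 9; 20; 15; 12; 19; 6; 11; 8;
                   18; 17; 13; 10; 21; 5], 1);
              ([:: 0; 1; 2; 3; 8; 17; 20; 16; 4; 9; 14; 19; 12; 15; 10; 13; 7;
                   5; 22; 11; 6; 21; 18], 1)]);
      (9, [:: ([:: 0; 1; 2; 3; 4; 11; 18; 16; 7; 21; 22; 14; 9; 10; 5; 20; 8;
                   15; 19; 6; 17; 12; 13], 2)])]
  ++ [seq (x, [::]) | x <- [:: 5, 6, 7, 8 & iota 10 13]].

Lemma M23_chain_ok : chain_ok [::] M23_chain.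
Proof. by vm_compute. Qed.

Theorem theorem6 : has_OGS M23.
Proof.
apply: (has_OGS_factorizes (s := chain_perms M23_chain)).
have -> : M23 = stab [::] :> {set 'S_23}.
  by apply/setP => s; apply/idP/stabP => [sM | []].
exact: factorizes_chain M23_chain_ok.
Qed.
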